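(* The length of a maximal chain in the poset of associated sets of $IP_{A,c}$ (ordered by inclusion) is at most $\min\left(d,\ 2^{n-d}-(n-d+1)\right)$.
   Context: $\mathbb{N}$ denotes the non-negative integers. $A \in \mathbb{Z}^{d\times n}$ is a fixed matrix of rank $d$ with columns $a_1,\dots,a_n$; $\mathrm{cone}(A)=\{Au : u\in\mathbb{R}^n, u\ge 0\}$ is pointed and $\{u\in\mathbb{R}^n: Au=0, u\ge 0\}=\{0\}$; $\mathbb{N}A=\{Au: u\in\mathbb{N}^n\}$. For $b\in\mathbb{N}A$, $IP_{A,c}(b)$ is the program $\min\{c\cdot x: Ax=b, x\in\mathbb{N}^n\}$; $IP_{A,c}$ is the family of these programs. The cost vector $c\in\mathbb{Z}^n$ is generic, i.e. each $IP_{A,c}(b)$, $b\in\mathbb{N}A$, has a unique optimal solution. For $\sigma\subseteq\{1,\dots,n\}$, $\bar\sigma$ is the complement, $A_\sigma$ the submatrix of columns indexed by $\sigma$, $x_\sigma$ the subvector indexed by $\sigma$. The regular triangulation $\Delta_c$ is the set of all $\sigma\subseteq\{1,\dots,n\}$ for which there is $y\in\mathbb{R}^d$ with $y\cdot a_j=c_j$ for $j\in\sigma$ and $y\cdot a_j<c_j$ for $j\notin\sigma$; its elements are called faces (by genericity, they label a complex of simplicial cones $\mathrm{cone}(A_\sigma)$ with support $\mathrm{cone}(A)$, whose maximal faces have $d$ elements). Group relaxation: for $\tau\in\Delta_c$ and $b\in\mathbb{N}A$, $G^\tau(b)$ is the program $\min\{\tilde c_{\bar\tau}\cdot x_{\bar\tau}: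 A_\tau x_\tau+A_{\bar\tau}x_{\bar\tau}=b,\ x_{\bar\tau}\ge 0,\ (x_\tau,x_{\bar\tau})\in\mathbb{Z}^n\}$, where $\tilde c_{\bar\tau}$ consists of the coordinates indexed by $\bar\tau$ of $c-c_\sigma A_\sigma^{-1}A$ for any maximal face $\sigma\supseteq\tau$ of $\Delta_c$. $G^\tau(b)$ solves $IP_{A,c}(b)$ if its (unique) optimal solution $x^*\in\mathbb{Z}^n$ is non-negative (equivalently, equals the optimal solution of $IP_{A,c}(b)$). Associated set: a face $\tau\in\Delta_c$ such that for some $b\in\mathbb{N}A$, $G^\tau(b)$ solves $IP_{A,c}(b)$ but $G^{\tau'}(b)$ does not, for every face $\tau'\in\Delta_c$ with $\tau\subsetneq\tau'$. The length of a chain $\tau_0\subsetneq\tau_1\subsetneq\dots\subsetneq\tau_k$ is $k$. *)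

(* Defs.v *)
From mathcomp Require Import all_boot all_order all_algebra.
From mathcomp Require Import reals.

Import Order.TTheory GRing.Theory Num.Theory.
Local Open Scope ring_scope.

Definition mxR (R : realType) {m n : nat} (M : 'M[int]_(m, n)) : 'M[R]_(m, n) :=
  map_mx intr M.

Definition nonneg {F : numDomainType} {n : nat} (u : 'cV[F]_n) : Prop :=
  forall i, 0 <= u i 0.

Definition minimizer {F : numDomainType} {T : Type} (feasible : T -> Prop)
    (cost : T -> F) (x : T) : Prop :=
  feasible x /\ forall x', feasible x' -> cost x <= cost x'.

Definition in_cone (R : realType) {d n : nat} (A : 'M[int]_(d, n))
    (v : 'cV[R]_d) : Prop :=
  exists2 u : 'cV[R]_n, nonneg u & mxR R A *m u = v.

Definition pointed_cone (R : realType) {d n : nat} (A : 'M[int]_(d, n)) : Prop :=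
  forall v : 'cV[R]_d, in_cone R A v -> in_cone R A (- v) -> v = 0.

(* Elements of N^n are represented as nonnegative integer vectors. *)
Definition in_NA {d n : nat} (A : 'M[int]_(d, n)) (b : 'cV[int]_d) : Prop :=
  exists2 u : 'cV[int]_n, nonneg u & A *m u = b.

Definition IP_feasible {d n : nat} (A : 'M[int]_(d, n)) (b : 'cV[int]_d)
    (x : 'cV[int]_n) : Prop :=
  A *m x = b /\ nonneg x.

Definition IP_optimal {d n : nat} (A : 'M[int]_(d, n)) (c : 'rV[int]_n)
    (b : 'cV[int]_d) : 'cV[int]_n -> Prop :=
  minimizer (IP_feasible A b) (fun x => (c *m x) 0 0).

Definition generic_cost {d n : nat} (A : 'M[int]_(d, n)) (c : 'rV[int]_n) : Prop :=
  forall b, in_NA A b -> exists! x, IP_optimal A c b x.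

Definition face (R : realType) {d n : nat} (A : 'M[int]_(d, n)) (c : 'rV[int]_n)
    (sigma : {set 'I_n}) : Prop :=
  exists y : 'rV[R]_d,
    (forall j, j \in sigma -> (y *m mxR R A) 0 j = mxR R c 0 j) /\
    (forall j, j \notin sigma -> (y *m mxR R A) 0 j < mxR R c 0 j).

Definition maximal_face (R : realType) {d n : nat} (A : 'M[int]_(d, n))
    (c : 'rV[int]_n) (sigma : {set 'I_n}) : Prop :=
  face R A c sigma /\
  forall sigma', face R A c sigma' -> sigma \subset sigma' -> sigma' = sigma.

Definition cols {R : realType} {m n : nat} (sigma : {set 'I_n}) (M : 'M[R]_(m, n)) :
    'M[R]_(m, #|sigma|) :=
  colsub (fun k : 'I_#|sigma| => enum_val k) M.

(* The vector c - c_sigma A_sigma^-1 A. For a maximal face sigma, A_sigma is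
   d x #|sigma| with #|sigma| = d only propositionally, so its inverse is written
   with pinvmx, which is defined for all shapes and is the inverse of an
   invertible matrix. *)
Definition reduced_cost (R : realType) {d n : nat} (A : 'M[int]_(d, n))
    (c : 'rV[int]_n) (sigma : {set 'I_n}) : 'rV[R]_n :=
  mxR R c - cols sigma (mxR R c) *m pinvmx (cols sigma (mxR R A)) *m mxR R A.

Definition group_feasible {d n : nat} (A : 'M[int]_(d, n)) (tau : {set 'I_n})
    (b : 'cV[int]_d) (x : 'cV[int]_n) : Prop :=
  A *m x = b /\ forall j, j \notin tau -> 0 <= x j 0.

Definition group_optimal (R : realType) {d n : nat} (A : 'M[int]_(d, n))
    (c : 'rV[int]_n) (sigma tau : {set 'I_n}) (b : 'cV[int]_d) :
    'cV[int]_n -> Prop :=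
  minimizer (group_feasible A tau b)
    (fun x => \sum_(j | j \notin tau) reduced_cost R A c sigma 0 j * (x j 0)%:~R).

(* The choice of the maximal face sigma containing tau is immaterial: on the
   feasible set, where A x = b, the objectives for two choices differ by a
   constant (lemma group_optimal_indep below), so the existential could
   equivalently be a universal quantifier. *)
Definition group_solves (R : realType) {d n : nat} (A : 'M[int]_(d, n))
    (c : 'rV[int]_n) (tau : {set 'I_n}) (b : 'cV[int]_d) : Prop :=
  exists sigma, [/\ maximal_face R A c sigma, tau \subset sigma &
    exists2 x, group_optimal R A c sigma tau b x & nonneg x].

Definition associated (R : realType) {d n : nat} (A : 'M[int]_(d, n))
    (c : 'rV[int]_n) (tau : {set 'I_n}) : Prop :=
  face R A c tau /\
  exists b, [/\ in_NA A b, group_solves R A c tau b &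
    forall tau', face R A c tau' -> tau \proper tau' ->
      ~ group_solves R A c tau' b].

(* The chain t0 < t1 < ... < tk is given by t0 and s = [:: t1; ...; tk]; its
   length is size s. *)
Definition chain {n : nat} (P : {set 'I_n} -> Prop) (t0 : {set 'I_n})
    (s : seq {set 'I_n}) : Prop :=
  path (fun t t' : {set 'I_n} => t \proper t') t0 s /\
  forall t, t \in t0 :: s -> P t.

Definition maximal_chain {n : nat} (P : {set 'I_n} -> Prop) (t0 : {set 'I_n})
    (s : seq {set 'I_n}) : Prop :=
  chain P t0 s /\
  forall t0' s', chain P t0' s' -> {subset t0 :: s <= t0' :: s'} ->
    {subset t0' :: s' <= t0 :: s}.

Lemma reduced_cost_face (R : realType) (d n : nat) (A : 'M[int]_(d, n))
    (c : 'rV[int]_n) (sigma : {set 'I_n}) (j : 'I_n) :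
  face R A c sigma -> j \in sigma -> reduced_cost R A c sigma 0 j = 0.
Proof.
move=> [y [yE _]] js; set w := cols sigma (mxR R c) *m pinvmx (cols sigma (mxR R A)).
have sub : (cols sigma (mxR R c) <= cols sigma (mxR R A))%MS.
  apply/submxP; exists y; apply/matrixP=> i k; rewrite ord1 !mxE.
  have := yE _ (enum_valP k); rewrite !mxE => <-.
  by apply: eq_bigr => l _; rewrite !mxE.
have /matrixP/(_ 0 (enum_rank_in js j)) := mulmxKpV sub.
rewrite -/w !mxE enum_rankK_in // => wE; rewrite -/w -wE; apply/eqP; rewrite subr_eq0.
by apply/eqP/eq_bigr => l _; rewrite !mxE enum_rankK_in.
Qed.

Lemma group_optimal_indep (R : realType) (d n : nat) (A : 'M[int]_(d, n))
    (c : 'rV[int]_n) (sigma sigma' tau : {set 'I_n}) (b : 'cV[int]_d)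
    (x : 'cV[int]_n) :
  face R A c sigma -> face R A c sigma' -> tau \subset sigma ->
  tau \subset sigma' ->
  group_optimal R A c sigma tau b x -> group_optimal R A c sigma' tau b x.
Proof.
have costE s (y : 'cV[int]_n) : face R A c s -> tau \subset s -> A *m y = b ->
    \sum_(j | j \notin tau) reduced_cost R A c s 0 j * (y j 0)%:~R =
    (mxR R c *m mxR R y) 0 0 -
    (cols s (mxR R c) *m pinvmx (cols s (mxR R A)) *m mxR R b) 0 0.
  move=> fs /subsetP ts yb.
  rewrite -yb /mxR map_mxM -!/(mxR R _) mulmxA.
  have -> (u v : 'M[R]_1) : u 0 0 - v 0 0 = (u - v) 0 0 by rewrite !mxE.
  rewrite -mulmxBl -/(reduced_cost R A c s) mxE.
  rewrite [RHS](bigID (mem tau)) /= [X in _ = X + _]big1 ?add0r.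
    by apply: eq_bigr => j _; rewrite [mxR _ _ _ _]mxE.
  by move=> j jt; rewrite reduced_cost_face ?mul0r ?ts.
move=> fs fs' ts ts' [xf xopt]; split=> // x' x'f.
have := xopt _ x'f; have [xb _] := xf; have [x'b _] := x'f.
by rewrite !costE // !lerD2r.
Qed.

(* Main.v *)
Require Import Defs.
From mathcomp Require Import all_boot all_order all_algebra.
From mathcomp Require Import reals boolp ring lra zify.

Import Order.TTheory GRing.Theory Num.Theory.
Local Open Scope ring_scope.

Set Implicit Arguments.
Unset Strict Implicit.
Unset Printing Implicit Defensive.

(** Along a chain of associated sets the cardinality grows by at least one at each
    step, so its length is at most [#|t_k| - #|t_0|]. It remains to bound the
    cardinality of an associated set from above by [d] and from below by
    [n + 1 - 2 ^ (n - d)]; the difference of these bounds is the second entry of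
    the minimum.

    Both bounds rest on a description of faces by integer vectors. An improving
    direction for [sigma] is an integer vector of the kernel of [A], non-negative
    off [sigma], of negative cost. By linear programming duality over the
    rationals, for generic [c] the faces are exactly the sets without improving
    direction ([face_not_improves], [not_face_improves]). Genericity turns every
    non-zero kernel vector of cost zero, non-negative off [sigma], into an
    improving direction. In particular the columns of a face are linearly
    independent, which gives the upper bound [d] ([card_face]).

    For the lower bound, let [tau] be associated and let [x] be the optimum, which
    is non-negative, of the group relaxation at [tau]. In the coset of [x] modulo
    the lattice of integer vectors of the kernel of [A], no point is non-negative
    off [tau] and cheaper than [x]. However, as soon as one of these
    [n - #|tau| + 1] inequalities is dropped, such a point exists: if the
    non-negativity of the coordinate [j] is dropped, either [j |: tau] is a face
    whose relaxation does not solve the program, or it is not a face and there is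
    an improving direction for it; if the cost inequality is dropped, [x] itself is
    one ([associated_witnesses]). A theorem of Bell and Scarf says that such an
    irredundant system, infeasible on a lattice of rank [n - d], has at most
    [2 ^ (n - d)] inequalities ([bell_scarf]): once the right-hand sides are relaxed
    as far as possible, there are as many lattice points as inequalities and no
    two of them are congruent modulo twice the lattice, since their midpoint
    would satisfy the whole system. *)

(** * Theorems of the alternative over an ordered field *)

Lemma scale_dominates (F : realFieldType) (I : finType) (P : pred I) (p r : I -> F) :
  (forall i, P i -> 0 < p i) -> exists t, forall i, P i -> 0 < t * p i + r i.
Proof.
move=> p_gt0; exists (1 + \sum_(i | P i) `|r i| / p i) => i Pi.
have pi0 := p_gt0 i Pi; have -> : r i = (r i / p i) * p i by rewrite divfK ?gt_eqF.
rewrite -mulrDl mulr_gt0 // (bigD1 i) //=.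
have : 0 <= \sum_(j | P j && (j != i)) `|r j| / p j.
  by apply: sumr_ge0 => j /andP[Pj _]; rewrite divr_ge0 // ltW ?p_gt0.
have : 0 <= `|r i| / p i + r i / p i.
  by rewrite -mulrDl divr_ge0 ?(ltW pi0) // -lerBlDr sub0r -normrN ler_norm.
lra.
Qed.

(** Gordan's alternative, for the columns of [V] listed in [s]. Induction on [s]:
    given [y] positive on the old columns and not on the new one [w], all columns
    are projected along [w] onto the hyperplane orthogonal to [y]. A functional
    that is positive on the projections gives one that is positive on the old
    columns and vanishes on [w], and it suffices to perturb it; a dependency
    between the projections is a dependency between the columns, with a positive
    coefficient at [w]. *)
Lemma gordan (F : realFieldType) (d m : nat) (V : 'M[F]_(d, m)) (s : seq 'I_m) :
  (exists y : 'rV_d, forall i, i \in s -> 0 < (y *m V) 0 i) \/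
  (exists u : 'cV_m, [/\ u != 0, V *m u = 0, forall i, 0 <= u i 0 &
    forall i, i \notin s -> u i 0 = 0]).
Proof.
elim: s V => [|j s IH] V; first by left; exists 0.
case: (IH V) => [[y ypos]|[u [u0 Vu unneg us]]]; last first.
  by right; exists u; split=> // i; rewrite inE negb_or => /andP[_ /us].
have [yj|yj] := ltP 0 ((y *m V) 0 j).
  by left; exists y => i; rewrite inE => /orP[/eqP->|/ypos].
pose a := - (y *m V) 0 j; have a_ge0 : 0 <= a by rewrite oppr_ge0.
have colV (z : 'rV_d) : z *m col j V = ((z *m V) 0 j)%:M.
    by rewrite [LHS]mx11_scalar colE mulmxA -colE mxE.
  have [w0|w0] := eqVneq (col j V) 0.
  right; exists (delta_mx j 0); split.
  - by apply/eqP => /matrixP/(_ j 0); rewrite !mxE !eqxx => /eqP; rewrite oner_eq0.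
  - by rewrite -colE.
  - by move=> i; rewrite mxE; case: (_ && _).
  - by move=> i; rewrite inE negb_or !mxE => /andP[/negPf-> _].
(* These columns are the projections along [col j V], scaled by [a]; without a
   division the case [a = 0] is included. *)
case: (IH (a *: V + col j V *m (y *m V))) => [[z zpos]|[u [u0 Vu unneg us]]].
  pose y' := a *: z + (z *m V) 0 j *: y.
  have y'V : y' *m V = z *m (a *: V + col j V *m (y *m V)).
    by rewrite mulmxDl mulmxDr mulmxA colV mul_scalar_mx -!scalemxAl -scalemxAr.
  have y'j : (y' *m V) 0 j = 0.
    by rewrite mulmxDl -!scalemxAl !mxE /a; rewrite !mxE; ring.
  (* [y'] vanishes on column [j]; a large multiple of it absorbs the term [q]. *)
  pose q := (col j V)^T.
  have qj : 0 < (q *m V) 0 j.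
    have sq k : q 0 k * V k j = V k j ^+ 2 by rewrite !mxE expr2.
    rewrite mxE lt_def sumr_ge0 ?andbT => [|k _]; last by rewrite sq sqr_ge0.
    apply: contra w0 => /eqP/psumr_eq0P sq0; apply/eqP/matrixP=> k l; rewrite !mxE.
    apply/eqP; rewrite -sqrf_eq0 -sq sq0 // => {}k _; by rewrite sq sqr_ge0.
  have [t tP] := scale_dominates (P := mem s) (fun i => (q *m V) 0 i) zpos.
  left; exists (t *: y' + q) => i.
  rewrite mulmxDl -scalemxAl mxE [X in 0 < X + _]mxE inE.
  case/orP=> [/eqP->|si]; first by rewrite y'j mulr0 add0r.
  by rewrite y'V; exact: tP.
have b_gt0 : 0 < (y *m V *m u) 0 0.
  have term_ge0 i : 0 <= (y *m V) 0 i * u i 0.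
    have [si|/us->] := boolP (i \in s); last by rewrite mulr0.
    by rewrite mulr_ge0 // ltW ?ypos.
  rewrite mxE lt_def sumr_ge0 ?andbT //.
  apply: contra u0 => /eqP/psumr_eq0P t0; apply/eqP/matrixP=> i k.
  rewrite ord1 [RHS]mxE; have [si|/us//] := boolP (i \in s).
  have /eqP := t0 (fun i _ => term_ge0 i) i isT; rewrite mulf_eq0 => /orP[|/eqP//].
  by rewrite gt_eqF ?ypos.
right; exists (a *: u + (y *m V *m u) 0 0 *: delta_mx j 0); split.
- apply/eqP => /matrixP/(_ j 0).
  rewrite mxE [(_ *: delta_mx _ _) _ _]mxE !mxE !eqxx => /eqP.
  rewrite mulr1 gt_eqF // ltr_wpDl ?mulr_ge0 //.
  by rewrite mxE in b_gt0.
- have E : col j V *m (y *m V) *m u = (y *m V *m u) 0 0 *: col j V.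
    by rewrite -mulmxA {1}[y *m V *m u]mx11_scalar mul_mx_scalar.
  by rewrite mulmxDr -!scalemxAr -colE -E -[RHS]Vu mulmxDl -scalemxAl.
- move=> i; rewrite mxE addr_ge0 // mxE mulr_ge0 // ?(ltW b_gt0) //.
  by rewrite mxE; case: (_ && _).
- move=> i; rewrite inE negb_or => /andP[ij /us ui].
  rewrite mxE [(_ *: u) _ _]mxE ui [(_ *: delta_mx _ _) _ _]mxE.
  by rewrite [delta_mx _ _ _ _]mxE (negPf ij) !mulr0 addr0.
Qed.

(** Adding equality constraints to Gordan's alternative. The equality at [j] is
    obtained by combining a solution that is positive at [j] with one that is
    negative at [j]; the latter is a solution for the matrix whose column [j] has
    the opposite sign. *)
Lemma motzkin (F : realFieldType) (d m : nat) (V : 'M[F]_(d, m)) (e : seq 'I_m) :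
  (exists y : 'rV_d, (forall i, i \in e -> (y *m V) 0 i = 0) /\
     forall i, i \notin e -> 0 < (y *m V) 0 i) \/
  (exists u : 'cV_m, [/\ u != 0, V *m u = 0 & forall i, i \notin e -> 0 <= u i 0]).
Proof.
elim: e V => [|j e IH] V.
  case: (gordan V (enum 'I_m)) => [[y ypos]|[u [u0 Vu unneg _]]].
    by left; exists y; split=> // i _; rewrite ypos ?mem_enum.
  by right; exists u.
have weaken (u : 'cV[F]_m) : (forall i, i \notin e -> 0 <= u i 0) ->
    forall i, i \notin j :: e -> 0 <= u i 0.
  by move=> unneg i; rewrite inE negb_or => /andP[_ /unneg].
case: (IH V) => [[y [y0 ypos]]|[u [u0 Vu /weaken unneg]]]; last by right; exists u.
have [je|je] := boolP (j \in e).
  left; exists y; split=> i; first by rewrite inE => /orP[/eqP->|]; exact: y0.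
  by rewrite inE negb_or => /andP[_ /ypos].
pose D : 'rV[F]_m := \row_i (if i == j then -1 else 1).
have DE (z : 'rV[F]_d) i : (z *m (V *m diag_mx D)) 0 i =
    (if i == j then - (z *m V) 0 i else (z *m V) 0 i).
  by rewrite mulmxA mul_mx_diag !mxE; case: (i == j); rewrite ?mulrN1 ?mulr1.
case: (IH (V *m diag_mx D)) => [[z [z0 zpos]]|[u [u0 Vu unneg]]].
  have yj := ypos j je; have := zpos j je; rewrite DE eqxx oppr_gt0 => zj.
  left; exists (- (z *m V) 0 j *: y + (y *m V) 0 j *: z).
  have E i : ((- (z *m V) 0 j *: y + (y *m V) 0 j *: z) *m V) 0 i =
      - (z *m V) 0 j * (y *m V) 0 i + (y *m V) 0 j * (z *m V) 0 i.
    by rewrite mulmxDl -!scalemxAl mxE [X in X + _ = _]mxE [X in _ + X = _]mxE.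
  split=> i; rewrite E inE.
    have [->|ij] /= := eqVneq i j; first by move=> _; ring.
    by move=> ie; have := z0 i ie; rewrite DE (negPf ij) y0 // => ->; rewrite !mulr0 addr0.
  rewrite negb_or => /andP[ij ie].
  have := zpos i ie; rewrite DE (negPf ij) => zi; have yi := ypos i ie.
  by rewrite addr_gt0 // mulr_gt0 // oppr_gt0.
right; exists (diag_mx D *m u); split; last 1 first.
- move=> i; rewrite inE negb_or mul_diag_mx => /andP[ij /unneg].
  by rewrite !mxE (negPf ij) mul1r.
- apply: contra u0 => /eqP/matrixP Du0; apply/eqP/matrixP => i k.
  have := Du0 i k; rewrite mul_diag_mx !mxE.
  by case: (i == j); rewrite ?mul1r // mulN1r => /eqP; rewrite oppr_eq0 => /eqP.
- by rewrite mulmxA.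
Qed.

(** * Faces and integer directions *)

Lemma clear_denominators (n : nat) (u : 'cV[rat]_n) :
  exists k v, 0 < k /\ map_mx intr v = k%:~R *: u :> 'cV[rat]_n.
Proof.
exists (\prod_i denq (u i 0)).
exists (\col_i (numq (u i 0) * \prod_(j | j != i) denq (u j 0))).
split; first by apply: prodr_gt0 => i _; exact: denq_gt0.
apply/matrixP=> i j; rewrite ord1 !mxE [in RHS](bigD1 i) //= !rmorphM /=.
by rewrite -[X in _ = _ * X]divq_num_den; field; rewrite intr_eq0 denq_eq0.
Qed.

(** Duality for the system that defines a face. The alternative is solved over the
    rationals, so that the dual vector can be scaled to an integer one; a rational
    solution of the primal system is also a real one. *)
Lemma face_alternative (R : realType) (d n : nat) (A : 'M[int]_(d, n))
    (c : 'rV[int]_n) (sigma : {set 'I_n}) :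
  face R A c sigma \/
  exists u : 'cV[int]_n, [/\ u != 0, A *m u = 0, (c *m u) 0 0 <= 0 &
    forall j, j \notin sigma -> 0 <= u j 0].
Proof.
pose Aq := map_mx intr A : 'M[rat]_(d, n); pose cq := map_mx intr c : 'rV[rat]_n.
(* Homogenization: a functional is a pair [(y, t)], its value at the first column
   is [t] and its value at column [j] is [t * c_j - y . a_j]. *)
pose V := block_mx (0 : 'M_(d, 1)) (- Aq) 1%:M cq.
pose e := [seq rshift 1 j | j <- enum sigma].
have memr j : (rshift 1 j \in e) = (j \in sigma).
  by rewrite mem_map ?mem_enum //; exact: rshift_inj.
have meml : lshift n 0 \notin e.
  by apply/mapP => -[j _ /eqP]; rewrite eq_lrshift.
case: (motzkin V e) => [[y [y0 ypos]]|[u [u0 Vu unneg]]].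
  left; have yV : y *m V = row_mx (rsubmx y) (rsubmx y *m cq - lsubmx y *m Aq).
    rewrite -{1}[y]hsubmxK mul_row_block mulmx0 add0r mulmx1 mulmxN.
    by rewrite [X in row_mx _ X]addrC.
  pose t := rsubmx y 0 0.
  have t_gt0 : 0 < t by have := ypos _ meml; rewrite yV row_mxEl.
  have yVr j : (y *m V) 0 (rshift 1 j) = t * cq 0 j - (lsubmx y *m Aq) 0 j.
    rewrite yV row_mxEr [rsubmx y]mx11_scalar mul_scalar_mx.
    by rewrite mxE [X in X + _]mxE [X in _ + X]mxE.
  exists (map_mx ratr (t^-1 *: lsubmx y)).
  have -> : mxR R A = map_mx ratr Aq.
    by apply/matrixP=> i j; rewrite !mxE ratr_int.
  have cE j : mxR R c 0 j = ratr (cq 0 j) by rewrite !mxE ratr_int.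
  rewrite -map_mxM -scalemxAl.
  split=> j js; rewrite cE mxE /= [X in ratr X]mxE.
    have := y0 (rshift 1 j); rewrite memr yVr => /(_ js)/eqP; rewrite subr_eq0 => /eqP<-.
    by rewrite mulKf ?gt_eqF.
  have := ypos (rshift 1 j); rewrite memr yVr => /(_ js); rewrite subr_gt0 => lt_yc.
  by rewrite ltr_rat ltr_pdivrMl.
right; have [k [v [k_gt0 vE]]] := clear_denominators (dsubmx u).
have Vu' := Vu; rewrite -[u]vsubmxK mul_block_col mul0mx add0r mul1mx mulNmx in Vu'.
have [/eqP] : - (Aq *m dsubmx u) = 0 /\ usubmx u + cq *m dsubmx u = 0.
  by apply/eq_col_mx; rewrite Vu' col_mx0.
rewrite oppr_eq0 => /eqP Au cu.
have inj m1 m2 : injective (map_mx intr : 'M[int]_(m1, m2) -> 'M[rat]_(m1, m2)).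
  move=> M N /matrixP MN; apply/matrixP=> i j; apply/eqP.
  by have /eqP := MN i j; rewrite !mxE eqr_int.
have u0_ge0 := unneg _ meml.
have cv : (cq *m dsubmx u) 0 0 = - u (lshift n 0) 0.
  move/eqP: cu; rewrite addrC addr_eq0 => /eqP->; rewrite !mxE.
  by congr (- u _ _); apply: val_inj.
exists v; split.
- apply: contra u0 => /eqP v0; move: vE; rewrite v0 map_mx0 => /esym/eqP.
  rewrite scaler_eq0 intr_eq0 gt_eqF //= => /eqP u1.
  have := cu; rewrite u1 mulmx0 addr0 => u2.
  by rewrite -[u]vsubmxK u1 u2 col_mx0.
- by apply: inj; rewrite map_mxM vE -scalemxAr Au scaler0 map_mx0.
- have : (map_mx intr (c *m v)) 0 0 <= 0 :> rat.
    rewrite map_mxM vE -scalemxAr mxE cv mulrN oppr_le0 mulr_ge0 //.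
    by rewrite ler0z ltW.
  by rewrite mxE lerz0.
- move=> j js; have := unneg (rshift 1 j); rewrite memr => /(_ js) uj.
  have : 0 <= (map_mx intr v) j 0 :> rat.
    by rewrite vE mxE mulr_ge0 // ?ler0z ?(ltW k_gt0) // mxE.
  by rewrite mxE ler0z.
Qed.

Definition improves {d n : nat} (A : 'M[int]_(d, n)) (c : 'rV[int]_n)
    (sigma : {set 'I_n}) (u : 'cV[int]_n) : Prop :=
  [/\ A *m u = 0, (c *m u) 0 0 < 0 & forall j, j \notin sigma -> 0 <= u j 0].

Lemma face_not_improves (R : realType) (d n : nat) (A : 'M[int]_(d, n))
    (c : 'rV[int]_n) (sigma : {set 'I_n}) (u : 'cV[int]_n) :
  face R A c sigma -> ~ improves A c sigma u.
Proof.
move=> [y [yE ylt]] [Au cu unneg].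
have : 0 <= ((mxR R c - y *m mxR R A) *m mxR R u) 0 0.
  rewrite mxE sumr_ge0 // => j _.
  have [js|js] := boolP (j \in sigma).
    by rewrite mxE [X in _ + X]mxE yE // subrr mul0r.
  rewrite mulr_ge0 //; last by rewrite mxE ler0z unneg.
  by rewrite mxE [X in _ + X]mxE subr_ge0 ltW ?ylt.
rewrite mulmxBl -mulmxA /mxR -!map_mxM Au map_mx0 mulmx0 subr0 mxE ler0z.
by rewrite leNgt cu.
Qed.

(** If [c u = 0], the positive and negative parts of [u] are two distinct feasible
    points of the same program, with the same cost. They are not both optimal, so
    there is a cheaper feasible point [w]; since the negative part [q] vanishes off
    [sigma], the difference [w - q] improves. *)
Lemma generic_improves (d n : nat) (A : 'M[int]_(d, n)) (c : 'rV[int]_n)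
    (sigma : {set 'I_n}) (u : 'cV[int]_n) :
  generic_cost A c -> u != 0 -> A *m u = 0 -> (c *m u) 0 0 <= 0 ->
  (forall j, j \notin sigma -> 0 <= u j 0) -> exists u', improves A c sigma u'.
Proof.
move=> genc u0 Au; rewrite le_eqVlt => /orP[/eqP cu|cu] unneg; last by exists u.
pose p := \col_j Num.max (u j 0) 0; pose q := \col_j Num.max (- u j 0) 0.
have pE : p = u + q.
  apply/matrixP=> j k; rewrite ord1 !mxE.
  by case: (leP (u j 0) 0); case: (leP (- u j 0) 0); lra.
have pn : nonneg p by move=> j; rewrite mxE le_max lexx orbT.
have qn : nonneg q by move=> j; rewrite mxE le_max lexx orbT.
have Ap : A *m p = A *m q by rewrite pE mulmxDr Au add0r.
have cp : (c *m p) 0 0 = (c *m q) 0 0 by rewrite pE mulmxDr mxE cu add0r.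
have [w [[[wf wn] wopt] wuniq]] := genc (A *m q) (ex_intro2 _ _ q qn erefl).
have [cw|cw] := ltP ((c *m w) 0 0) ((c *m q) 0 0).
  exists (w - q); split.
  - by rewrite mulmxBr wf subrr.
  - by rewrite mulmxBr mxE [X in _ + X]mxE subr_lt0.
  - by move=> j /unneg uj; have := wn j; rewrite !mxE; case: (leP (- u j 0) 0); lra.
have opt x : nonneg x -> A *m x = A *m q -> (c *m x) 0 0 = (c *m q) 0 0 ->
    IP_optimal A c (A *m q) x.
  by move=> xn xf cx; split=> // z /wopt; rewrite cx; exact: le_trans.
have /eqP := etrans (esym (wuniq p (opt p pn Ap cp))) (wuniq q (opt q qn erefl erefl)).
by rewrite pE -subr_eq0 addrK (negPf u0).
Qed.

Lemma not_face_improves (R : realType) (d n : nat) (A : 'M[int]_(d, n))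
    (c : 'rV[int]_n) (sigma : {set 'I_n}) :
  generic_cost A c -> ~ face R A c sigma -> exists u, improves A c sigma u.
Proof.
move=> genc; case: (face_alternative R A c sigma) => // -[u []] *.
exact: (generic_improves (u := u)).
Qed.

(** More than [d] columns are linearly dependent. An integer dependency supported on
    [sigma], or its opposite, has non-positive cost and thus gives an improving
    direction. *)
Lemma card_face (R : realType) (d n : nat) (A : 'M[int]_(d, n))
    (c : 'rV[int]_n) (sigma : {set 'I_n}) :
  generic_cost A c -> face R A c sigma -> (#|sigma| <= d)%N.
Proof.
move=> genc fs; rewrite leqNgt; apply/negP => card_gt.
(* [P] extends by zero a vector indexed by [sigma]. *)
pose P : 'M[rat]_(n, #|sigma|) := colsub (fun k => enum_val k) 1%:M.
have : kermx (map_mx intr A *m P)^T != 0.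
  rewrite -mxrank_eq0 mxrank_ker subn_eq0 -ltnNge.
  by apply: leq_ltn_trans card_gt; exact: rank_leq_col.
case/rowV0Pn=> w /sub_kermxP wA w0.
have APw : map_mx intr A *m (P *m w^T) = 0.
  by rewrite mulmxA -[LHS]trmxK trmx_mul trmxK wA trmx0.
have Pw_out j : j \notin sigma -> (P *m w^T) j 0 = 0.
  move=> js; rewrite mxE big1 // => k _; rewrite !mxE.
  by case: eqP js => [->|_ _]; rewrite ?enum_valP ?mul0r.
have Pw0 : P *m w^T != 0.
  apply: contra w0 => /eqP/matrixP E; apply/eqP/matrixP=> i k; rewrite ord1.
  have := E (enum_val k) 0.
  rewrite [LHS]mxE (bigD1 k) //= !mxE eqxx mul1r big1 ?addr0 //.
  move=> l lk; rewrite !mxE; case: eqP => [/enum_val_inj kl|]; last by rewrite mul0r.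
  by rewrite kl eqxx in lk.
have [k [v [k_gt0 vE]]] := clear_denominators (P *m w^T).
have Av : A *m v = 0.
  apply/matrixP=> i j; apply/eqP; rewrite -(eqr_int rat).
  have /matrixP/(_ i j) : map_mx intr (A *m v) = 0 :> 'cV[rat]_d.
    by rewrite map_mxM vE -scalemxAr APw scaler0.
  by rewrite !mxE => ->.
have v0 : v != 0.
  apply: contra Pw0 => /eqP v0; move: vE; rewrite v0 map_mx0 => /esym/eqP.
  by rewrite scaler_eq0 intr_eq0 gt_eqF.
have v_out j : j \notin sigma -> v j 0 = 0.
  move=> js; apply/eqP; rewrite -(eqr_int rat); have /matrixP/(_ j 0) := vE.
  by rewrite mxE [RHS]mxE Pw_out // mulr0 => ->.
have [cv|cv] := leP ((c *m v) 0 0) 0.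
  have [|u] := generic_improves (sigma := sigma) genc v0 Av cv;
    last exact: face_not_improves fs.
  by move=> j /v_out->.
have [||||u] := generic_improves (sigma := sigma) (u := - v) genc;
  last exact: face_not_improves fs.
- by rewrite oppr_eq0.
- by rewrite mulmxN Av oppr0.
- by rewrite mulmxN mxE oppr_le0 ltW.
- by move=> j /v_out vj; rewrite mxE vj oppr0.
Qed.

(** * Associated sets *)

Lemma extend_to_maximal_face (R : realType) (d n : nat) (A : 'M[int]_(d, n))
    (c : 'rV[int]_n) (tau : {set 'I_n}) :
  face R A c tau -> exists2 sigma, maximal_face R A c sigma & tau \subset sigma.
Proof.
move=> ft; have [|sigma /maxsetP[/asboolP fs smax] ts] :=
  @maxset_exists _ (fun s => `[< face R A c s >]) tau.
  exact/asboolP.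
by exists sigma => //; split=> // s' /asboolP fs' /(smax _ fs').
Qed.

Lemma reduced_cost_sum (R : realType) (d n : nat) (A : 'M[int]_(d, n))
    (c : 'rV[int]_n) (sigma tau : {set 'I_n}) :
  face R A c sigma -> tau \subset sigma -> exists K : 'rV[R]_d, forall x : 'cV[int]_n,
    \sum_(j | j \notin tau) reduced_cost R A c sigma 0 j * (x j 0)%:~R =
    ((c *m x) 0 0)%:~R - (K *m mxR R (A *m x)) 0 0.
Proof.
move=> fs /subsetP ts.
exists (cols sigma (mxR R c) *m pinvmx (cols sigma (mxR R A))) => x.
have -> : ((c *m x) 0 0)%:~R = (mxR R c *m mxR R x) 0 0 by rewrite /mxR -map_mxM [RHS]mxE.
rewrite /mxR map_mxM -!/(mxR R _) mulmxA.
have -> (u v : 'M[R]_1) : u 0 0 - v 0 0 = (u - v) 0 0 by rewrite !mxE.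
rewrite -mulmxBl -/(reduced_cost R A c sigma) mxE.
rewrite [RHS](bigID (mem tau)) /= [X in _ = X + _]big1 ?add0r.
  by apply: eq_bigr => j _; rewrite [mxR _ _ _ _]mxE.
by move=> j jt; rewrite reduced_cost_face ?mul0r ?ts.
Qed.

(** On the feasible set the objective of the group relaxation differs from [c x] by
    a constant, so the maximal face of which it is made can be forgotten. *)
Lemma group_solvesP (R : realType) (d n : nat) (A : 'M[int]_(d, n))
    (c : 'rV[int]_n) (tau : {set 'I_n}) (b : 'cV[int]_d) :
  face R A c tau -> group_solves R A c tau b <->
  exists2 x, minimizer (group_feasible A tau b) (fun x => (c *m x) 0 0) x & nonneg x.
Proof.
move=> ft.
have costE sigma x z : face R A c sigma -> tau \subset sigma ->
    group_feasible A tau b x -> group_feasible A tau b z ->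
    (\sum_(j | j \notin tau) reduced_cost R A c sigma 0 j * (x j 0)%:~R <=
     \sum_(j | j \notin tau) reduced_cost R A c sigma 0 j * (z j 0)%:~R) =
    ((c *m x) 0 0 <= (c *m z) 0 0).
  move=> fs ts [xb _] [zb _]; have [K KE] := reduced_cost_sum fs ts.
  by rewrite !KE xb zb lerD2r ler_int.
split=> [[sigma [[fs _] ts [x [xf xopt] xn]]]|[x [xf xopt] xn]].
  by exists x => //; split=> // z zf; have := xopt z zf; rewrite (costE sigma).
have [sigma ms ts] := extend_to_maximal_face ft.
exists sigma; split=> //; exists x => //; split=> // z zf.
by rewrite (costE sigma) ?xopt //; case: ms.
Qed.

(** The inequalities off [tau], together with the strict bound on the cost, form a
    system that is infeasible and irredundant on the coset of [x]. The point [z]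
    for [j] comes from the failure of the relaxation at [j |: tau] when this is a
    face, and from an improving direction otherwise. *)
Lemma associated_witnesses (R : realType) (d n : nat) (A : 'M[int]_(d, n))
    (c : 'rV[int]_n) (tau : {set 'I_n}) :
  generic_cost A c -> associated R A c tau ->
  exists2 x : 'cV[int]_n, nonneg x &
    (forall z, A *m z = A *m x -> (forall j, j \notin tau -> 0 <= z j 0) ->
       (c *m x) 0 0 <= (c *m z) 0 0) /\
    (forall j, j \notin tau -> exists z, [/\ A *m z = A *m x,
       (c *m z) 0 0 < (c *m x) 0 0 & forall i, i \notin tau -> i != j -> 0 <= z i 0]).
Proof.
move=> genc [ft [b [_ tau_solves not_solved]]].
have [x [[xb xt] xopt] xn] := (group_solvesP _ ft).1 tau_solves.
exists x => //; split=> [z zx zn|j jt]; first by apply: xopt; rewrite /group_feasible zx xb.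
have outU i : i \notin j |: tau -> i \notin tau /\ i != j.
  by rewrite in_setU1 negb_or => /andP[].
have [fj|/(not_face_improves genc)[u [Au cu un]]] :=
  pselect (face R A c (j |: tau)).
  have tj : tau \proper j |: tau.
    by rewrite properE subsetUr; apply/subsetPn; exists j; rewrite ?setU11.
  apply: contrapT => no_z; apply: (not_solved _ fj tj); apply/group_solvesP=> //.
  exists x => //; split; first by split=> // i _; exact: xn.
  move=> z [zb zn]; rewrite leNgt; apply/negP => cz; apply: no_z; exists z.
  by split; rewrite ?xb // => i it ij; apply: zn; rewrite in_setU1 negb_or ij.
exists (x + u); split.
- by rewrite mulmxDr Au addr0.
- by rewrite mulmxDr mxE gtrDl.
- move=> i it ij; rewrite mxE addr_ge0 ?un //.
  by rewrite in_setU1 negb_or ij.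
Qed.

(** * The theorem of Bell and Scarf *)

(** The thresholds [g] are raised one unit at a time as long as no point is strictly
    below all of them. The point [x i] is strictly below every threshold except the
    one at [i], so that [g i] never exceeds [f i (x i)] and the process stops. At
    that stage a further unit at [i] lets in a point [y i], which is then exactly at
    the threshold [i] and strictly below all others. *)
Lemma saturate_thresholds (I : finType) (T : Type) (P : T -> Prop) (f : I -> T -> int)
    (g : I -> int) (x : I -> T) :
  (forall i, P (x i)) -> (forall i j, j != i -> f i (x j) < g i) ->
  (forall z, P z -> exists i, g i <= f i z) ->
  exists y : I -> T, [/\ forall i, P (y i),
    forall i j, j != i -> f i (y j) < f i (y i) &
    forall z, P z -> exists i, f i (y i) <= f i z].
Proof.
move=> Px.
have [N] : exists N : nat, \sum_i (f i (x i) - g i) < N%:Z.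
  by exists `|\sum_i (f i (x i) - g i)|.+1; lia.
elim: N g => [|N IH] g sum_lt fx gP.
  suff : 0 <= \sum_i (f i (x i) - g i) by rewrite leNgt sum_lt.
  apply: sumr_ge0 => i _; rewrite subr_ge0; have [j] := gP _ (Px i).
  by have [<-|/fx fji] := eqVneq i j; rewrite // leNgt fji.
pose bump i k := g k + (k == i)%:R.
have [[i iP]|stuck] := pselect (exists i, forall z, P z -> exists k, bump i k <= f k z).
  apply: (IH (bump i)) iP => [|k j /fx fkj]; last first.
    by apply: lt_le_trans fkj _; rewrite lerDl; case: (k == i).
  suff : \sum_k (f k (x k) - bump i k) = \sum_k (f k (x k) - g k) - 1 by lia.
  under eq_bigr => k _ do rewrite opprD addrA.
  rewrite sumrB; congr (_ - _).
  by rewrite (bigD1 i) //= eqxx big1 ?addr0 // => k /negPf->.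
have /fin_all_exists[y yP] : forall i, exists z, P z /\ forall k, f k z < bump i k.
  move=> i; apply: contrapT => no_y; apply: stuck; exists i => z Pz.
  apply: contrapT => no_k; apply: no_y; exists z; split=> // k.
  by rewrite ltNge; apply/negP => le_k; apply: no_k; exists k.
have lt_g i j : j != i -> f i (y j) < g i.
  by move=> ji; have [_ /(_ i)] := yP j; rewrite /bump eq_sym (negPf ji) addr0.
have yE i : f i (y i) = g i.
  have [Pyi /(_ i)] := yP i; rewrite /bump eqxx ltzD1 => le_i; have [k] := gP _ Pyi.
  have [<- ge_i|ik] := eqVneq i k; first by apply/le_anti; rewrite le_i.
  by rewrite leNgt lt_g.
exists y; split=> [i|i j /lt_g|z /gP[i]]; first by have [] := yP i.
  by rewrite yE.
by exists i; rewrite yE.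
Qed.

(** A non-zero minor over [K] is the image of a non-zero integer, whose image in
    characteristic zero does not vanish. *)
Lemma rank_intr_le (K : fieldType) (F : numFieldType) (m n : nat) (M : 'M[int]_(m, n)) :
  (\rank (map_mx intr M : 'M[K]_(m, n)) <= \rank (map_mx intr M : 'M[F]_(m, n)))%N.
Proof.
pose MK : 'M[K]_(m, n) := map_mx intr M.
have full : row_full (rowsub (maxrankfun MK) MK)^T.
  by rewrite /row_full mxrank_tr; exact: maxrowsub_free.
pose N := rowsub (fullrankfun full) (rowsub (maxrankfun MK) M)^T.
have NF (L : fieldType) : map_mx intr N =
    rowsub (fullrankfun full) (rowsub (maxrankfun MK) (map_mx intr M : 'M[L]_(m, n)))^T.
  by apply/matrixP=> i j; rewrite !mxE.
have detN : \det N != 0.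
  have := fullrowsub_unit full; rewrite -NF unitmxE det_map_mx unitfE.
  by apply: contraNneq => ->; rewrite rmorph0.
have : map_mx intr N \in @unitmx F _.
  by rewrite unitmxE det_map_mx unitfE intr_eq0.
move/mxrank_unit; rewrite NF => {1}<-.
have rank_rowsub p q r (h : 'I_p -> 'I_q) (B : 'M[F]_(q, r)) :
    (\rank (rowsub h B) <= \rank B)%N.
  by rewrite -[B in rowsub h B]mul1mx -mul_rowsub_mx mxrankM_maxr.
by apply: leq_trans (rank_rowsub _ _ _ _ _) _; rewrite mxrank_tr rank_rowsub.
Qed.

(** The points lie in one coset of the kernel lattice of [A]. Their differences with
    a fixed one, reduced modulo 2, are distinct and span a space over the field with
    two elements, of dimension at most the rank of the lattice. The kernel lattice is
    saturated, so congruence modulo twice the lattice is the same as congruence of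
    all coordinates modulo 2. *)
Lemma card_incongruent_mod2 (F : numFieldType) (d n : nat) (A : 'M[int]_(d, n))
    (I : finType) (y : I -> 'cV[int]_n) :
  (forall i j, A *m y i = A *m y j) ->
  (forall i j (w : 'cV[int]_n), y j = y i + w *+ 2 -> i = j) ->
  (#|I| <= 2 ^ (n - \rank (map_mx intr A : 'M[F]_(d, n))))%N.
Proof.
move=> Ay ymod2; case: (pickP I) => [i0 _|I0]; last by rewrite (eq_card0 I0).
pose V := \matrix_(k < #|I|, j < n) (y (enum_val k) - y i0) j 0.
pose V2 : 'M['F_2]_(#|I|, n) := map_mx intr V.
have rankV : (\rank V2 <= n - \rank (map_mx intr A : 'M[F]_(d, n)))%N.
  apply: leq_trans (rank_intr_le _ F V) _; rewrite leq_subRL ?rank_leq_col // addnC.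
  rewrite -[X in (_ + X)%N]mxrank_tr; apply: mulmx0_rank_max.
  rewrite map_trmx -map_mxM; suff -> : V *m A^T = 0 by rewrite map_mx0.
  apply/row_matrixP=> k; rewrite row_mul row0.
  have -> : row k V = (y (enum_val k) - y i0)^T by apply/matrixP=> a j; rewrite ord1 !mxE.
  by rewrite -trmx_mul mulmxBr (Ay _ i0) subrr trmx0.
have subV : (V2 <= row_base V2)%MS by rewrite eq_row_base.
pose coefs k := row k (V2 *m pinvmx (row_base V2)).
have coefs_inj : injective coefs.
  move=> k l /(congr1 (mulmx^~ (row_base V2))); rewrite -!row_mul mulmxKpV // => eq_row.
  apply: enum_val_inj.
  pose w : 'cV[int]_n := \col_j divz (y (enum_val l) j 0 - y (enum_val k) j 0) 2.
  apply: (ymod2 _ _ w).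
  apply/matrixP=> j a; rewrite ord1 !mxE.
  have /matrixP/(_ 0 j) := eq_row; rewrite !mxE => /esym/eqP.
  rewrite -subr_eq0 -rmorphB /= -(dvdz_pcharf (pchar_Fp (isT : prime 2))).
  have -> (p q r : int) : p - q - (r - q) = p - r by ring.
  by move/divzK => two; lia.
have := leq_card _ coefs_inj.
rewrite card_ord card_mx card_Fp // mul1n => /leq_trans; apply.
by rewrite leq_exp2l.
Qed.

(** After [saturate_thresholds], the midpoint of two congruent points [y i] and
    [y j] would be strictly below all thresholds, because the functions are affine
    and no threshold is attained at both. The first hypothesis on [f] says that it
    is affine at the midpoints of lattice segments. *)
Lemma bell_scarf (F : numFieldType) (d n : nat) (A : 'M[int]_(d, n)) (b : 'cV[int]_d)
    (I : finType) (f : I -> 'cV[int]_n -> int) (x : I -> 'cV[int]_n) :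
  (forall i (y w : 'cV[int]_n), f i y + f i (y + w *+ 2) = f i (y + w) *+ 2) ->
  (forall i, A *m x i = b) -> (forall i j, j != i -> f i (x j) <= 0) ->
  (forall z, A *m z = b -> exists i, 0 < f i z) ->
  (#|I| <= 2 ^ (n - \rank (map_mx intr A : 'M[F]_(d, n))))%N.
Proof.
move=> f_affine xb fx fP.
have [i j ji|y [yb ylt yP]] :=
  saturate_thresholds (P := fun z => A *m z = b) (f := f) (g := fun=> 1) xb _ fP.
  by have := fx i j ji; lia.
apply: (@card_incongruent_mod2 _ _ _ _ _ y) => [i j|i j w yj]; first by rewrite !yb.
apply/eqP/negPn/negP => ij.
have w0 : A *m w = 0.
  have := yb j; rewrite yj mulmxDr yb => /(canRL (addKr b)); rewrite addNr raddfMn => w2.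
  by apply/matrixP=> k l; have /matrixP/(_ k l) := w2; rewrite !mxE; lia.
have [|k] := yP (y i + w); first by rewrite mulmxDr yb w0 addr0.
have := f_affine k (y i) w; rewrite -yj mulr2n.
have [ki|ki] := eqVneq i k.
  by have := ylt k j; rewrite -ki eq_sym ij => /(_ isT); lra.
have [kj|kj] := eqVneq j k.
  by have := ylt k i ki; rewrite -kj; lra.
by have := ylt k i ki; have := ylt k j kj; lra.
Qed.

(** * Bounds on associated sets and chains *)

(** The irredundant system of [associated_witnesses] has one inequality for each
    element outside [tau] and one for the cost; [bell_scarf] bounds their number. *)
Lemma associated_codim (R : realType) (d n : nat) (A : 'M[int]_(d, n))
    (c : 'rV[int]_n) (tau : {set 'I_n}) :
  generic_cost A c -> associated R A c tau ->
  (n - #|tau| < 2 ^ (n - \rank (mxR R A)))%N.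
Proof.
move=> genc /(associated_witnesses genc)[x xn [xopt wit]].
pose I := option {j | j \notin tau}.
have cardI : #|{: I}| = (n - #|tau|).+1.
  rewrite card_option card_sig; congr _.+1; apply: (canRL (addKn _)).
  by rewrite -[RHS](card_ord n) -(cardC (mem tau)).
have /fin_all_exists[z zP] : forall j : {j | j \notin tau}, exists z,
    [/\ A *m z = A *m x, (c *m z) 0 0 < (c *m x) 0 0 &
      forall i, i \notin tau -> i != val j -> 0 <= z i 0].
  by case=> j jt; exact: wit.
(* The value is positive exactly when the inequality is violated; over the
   integers, [+ 1] accounts for the strictness of the cost inequality. *)
pose f (i : I) (y : 'cV[int]_n) : int :=
  if i is Some j then - y (val j) 0 else (c *m y) 0 0 - (c *m x) 0 0 + 1.
pose pt (i : I) := if i is Some j then z j else x.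
rewrite -cardI; apply: (@bell_scarf R _ _ A (A *m x) _ f pt).
- case=> [j|] y w /=; first by rewrite !mxE; ring.
  have D (p q : 'M[int]_1) : (p + q) 0 0 = p 0 0 + q 0 0 by rewrite mxE.
  by rewrite [w *+ 2]mulr2n !mulmxDr !D; ring.
- by case=> [j|] //=; have [] := zP j.
- case=> [i|] [j|] //= ji.
  + have [_ _ zn] := zP j; rewrite oppr_le0 zn ?(valP i) //.
    by apply: contra ji => /eqP/val_inj->.
  + by rewrite oppr_le0.
  + by have [_ lt_c _] := zP j; rewrite lezD1 subr_lt0.
- move=> y yb; have [yneg|ynn] := pselect (exists j : {j | j \notin tau}, y (val j) 0 < 0).
    by have [j yj] := yneg; exists (Some j); rewrite /= oppr_gt0.
  exists None; rewrite /= ltzD1 subr_ge0; apply: xopt => // j jt.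
  by rewrite leNgt; apply/negP => yj; apply: ynn; exists (exist _ j jt).
Qed.

Lemma path_proper_card (T : finType) (t0 : {set T}) (s : seq {set T}) :
  path (fun t t' : {set T} => t \proper t') t0 s -> (#|t0| + size s <= #|last t0 s|)%N.
Proof.
elim: s t0 => [|t s IH] t0 /=; first by rewrite addn0.
case/andP=> /proper_card lt_t /IH; apply: leq_trans.
by rewrite addnS -addSn leq_add2r.
Qed.

Theorem theorem5p4 (R : realType) (d n : nat) (A : 'M[int]_(d, n))
    (c : 'rV[int]_n)
    (rankA : \rank (mxR R A) = d)
    (pointedA : pointed_cone R A)
    (kerA : forall u : 'cV[R]_n, mxR R A *m u = 0 -> nonneg u -> u = 0)
    (genc : generic_cost A c)
    (t0 : {set 'I_n}) (s : seq {set 'I_n})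
    (maxs : maximal_chain (associated R A c) t0 s) :
  (size s <= minn d (2 ^ (n - d) - (n - d + 1)))%N.
Proof.
have [[s_path s_assoc] _] := maxs.
have [f_last _] := s_assoc _ (mem_last t0 s).
have size_le := leq_trans (path_proper_card s_path) (card_face genc f_last).
have := associated_codim genc (s_assoc _ (mem_head t0 s)); rewrite rankA.
have : (d <= n)%N by rewrite -rankA rank_leq_col.
move: size_le; move: #|t0| (2 ^ (n - d))%N => k N.
by rewrite leq_min => *; apply/andP; split; lia.
Qed.
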